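(* Let $D_4$ be the dihedral group of order $8$ and $D_4^k$ its $k$-fold direct power. Then, as $k\to\infty$, $$\alpha(D_4^k)\le(3+o(1))\log_{12}8,$$ where the right-hand side approaches $3\log_{12}8=2.51\dots$ as $k\to\infty$.
   Context: For a subset $S$ of a group, $Q(S)=\{s_1s_2^{-1}: s_1,s_2\in S\}$. A group $G$ realizes $\langle n_1,n_2,n_3\rangle$ if there are subsets $S_1,S_2,S_3\subseteq G$ with $|S_i|=n_i$ such that for all $q_i\in Q(S_i)$, if $q_1q_2q_3=1$ then $q_1=q_2=q_3=1$. The pseudo-exponent $\alpha(G)$ of a non-trivial finite group $G$ is the minimum of $\frac{3\log|G|}{\log nmp}$ over all positive integers $n,m,p$ (not all $1$) such that $G$ realizes $\langle n,m,p\rangle$; the pseudo-exponent of the trivial group is $3$. The dihedral group $D_m$ (of order $2m$) is generated by $x$ and $y$ with relations $y^2=x^m=1$ and $yxy=x^{-1}$. *)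

(* Defs.v *)
From mathcomp Require Import all_boot all_order all_algebra.
From mathcomp Require Import all_fingroup all_solvable.
From mathcomp Require Import all_classical all_reals all_analysis.

Set Implicit Arguments.
Unset Strict Implicit.
Unset Printing Implicit Defensive.

Import Order.TTheory GRing.Theory Num.Theory.
Import numFieldNormedType.Exports.

Local Open Scope classical_set_scope.
Local Open Scope ring_scope.

(* [dihedral m] has order 2 * m, whereas the library's type is indexed by its
   order: it is 'D_(2 * m) in extremal.v, a notation shadowed here by that of
   directional derivatives. Meaningful for 1 < m only. *)
Definition dihedral (m : nat) : finGroupType := dihedral_gtype m.*2.

Lemma card_dihedralT (m : nat) : (1 < m)%N -> #|dihedral m| = m.*2.
Proof. by move=> m1; rewrite -cardsT card_dihedral. Qed.

Lemma dihedral_presentation (m : nat) : (1 < m)%N ->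
  ([set: dihedral m]%SET \isog
     Grp (x : y : x ^+ m, y ^+ 2, (y * x * y) = x^-1))%g.
Proof.
move=> m1 rT H; rewrite Grp_dihedral//; apply: eq_existsb => -[x y] /=.
rewrite !xpair_eqE; do 2 apply: andb_id2l => _.
apply: andb_id2l => /eqP y2; have yV : (y^-1 = y)%g.
  by apply/eqP; rewrite eq_invg_mul -expg2 y2.
by rewrite conjgE yV mulgA.
Qed.

Definition group_pow (gT : finGroupType) (k : nat) : finGroupType :=
  {dffun forall i : 'I_k, gT}.

Definition quot_set (gT : finGroupType) (S : {set gT}) : {set gT} :=
  [set (s1 * s2^-1)%g | s1 in S, s2 in S]%SET.

Definition realizes (gT : finGroupType) (n1 n2 n3 : nat) : Prop :=
  exists S1 S2 S3 : {set gT},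
    [/\ #|S1| = n1, #|S2| = n2, #|S3| = n3 &
        forall q1 q2 q3 : gT,
          q1 \in quot_set S1 -> q2 \in quot_set S2 -> q3 \in quot_set S3 ->
          (q1 * q2 * q3 = 1)%g -> [/\ q1 = 1%g, q2 = 1%g & q3 = 1%g]].

Definition pseudo_exponent_candidates (R : realType) (gT : finGroupType) :
    set R :=
  [set a | exists n m p : nat,
    [/\ [/\ (0 < n)%N, (0 < m)%N & (0 < p)%N],
        ~ [/\ n = 1%N, m = 1%N & p = 1%N],
        realizes gT n m p &
        a = 3 * ln #|gT|%:R / ln (n * m * p)%:R]].
Arguments pseudo_exponent_candidates : clear implicits.

(* For a nontrivial group this infimum is a minimum:
   see [pseudo_exponent_min] below. *)
Definition pseudo_exponent (R : realType) (gT : finGroupType) : R :=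
  if #|gT| == 1%N then 3 else inf (pseudo_exponent_candidates R gT).

Definition logb (R : realType) (b x : R) : R := ln x / ln b.

Lemma pseudo_exponent_triv (R : realType) (gT : finGroupType) :
  #|gT| = 1%N -> pseudo_exponent R gT = 3.
Proof. by rewrite /pseudo_exponent => ->. Qed.

Lemma pseudo_exponent_min (R : realType) (gT : finGroupType) :
  #|gT| != 1%N ->
  pseudo_exponent_candidates R gT (pseudo_exponent R gT) /\
  lbound (pseudo_exponent_candidates R gT) (pseudo_exponent R gT).
Proof.
move=> G1; rewrite /pseudo_exponent (negbTE G1).
set A := pseudo_exponent_candidates R gT.
suff [a Aa lba] : exists2 a, A a & lbound A a.
  suff -> : inf A = a by [].
  apply/le_anti/andP; split; first by apply: ge_inf => //; exists a.
  by apply: lb_le_inf => //; exists a.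
have G0 : (0 < #|gT|)%N by apply/card_gt0P; exists 1%g.
pose P N := `[< exists n m p : nat,
  [/\ [/\ (0 < n)%N, (0 < m)%N & (0 < p)%N],
      ~ [/\ n = 1%N, m = 1%N & p = 1%N],
      realizes gT n m p & N = (n * m * p)%N] >].
have exP : exists N, P N.
  exists (#|gT| * 1 * 1)%N; apply/asboolP; exists #|gT|, 1%N, 1%N; split=> //.
    by move=> [g1 _ _]; rewrite g1 eqxx in G1.
  exists [set: gT]%SET, [set 1%g]%SET, [set 1%g]%SET.
  split; rewrite ?cardsT ?cards1//.
  move=> q1 q2 q3 _ /imset2P[x y /set1P-> /set1P-> ->].
  move=> /imset2P[z t /set1P-> /set1P-> ->].
  by rewrite invg1 !mulg1 => ->.
have bP N : P N -> (N <= #|gT| * #|gT| * #|gT|)%N.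
  move=> /asboolP[n [m [p [_ _ [S1 [S2 [S3 [<- <- <- _]]]] ->]]]].
  by rewrite !leq_mul// max_card.
case: (ex_maxnP exP bP) => N /asboolP[n [m [p [pos n1 rG eN]]]] maxN.
exists (3 * ln #|gT|%:R / ln N%:R).
  by exists n, m, p; rewrite eN; split.
move=> _ [n' [m' [p' [pos' n1' rG' ->]]]].
have gt1 : (1 < n' * m' * p')%N.
  case: pos' => a b c; rewrite ltn_neqAle !muln_gt0 a b c !andbT eq_sym.
  apply/eqP => /eqP; rewrite !muln_eq1 => /andP[/andP[/eqP? /eqP?] /eqP?].
  exact: n1'.
have leN : (n' * m' * p' <= N)%N.
  by apply: maxN; apply/asboolP; exists n', m', p'; split.
have ln0 : 0 < ln (n' * m' * p')%:R :> R by rewrite ln_gt0// ltr1n.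
have N1 : (1 < N)%N := leq_trans gt1 leN.
apply: ler_wpM2l; first by rewrite mulr_ge0// ln_ge0// ler1n.
rewrite lef_pV2 ?posrE// ?ln_gt0 ?ltr1n//.
by rewrite ler_ln ?posrE ?ltr0n ?ler_nat//; exact: ltnW.
Qed.

(* Main.v *)
(* Write x for the rotation of order 4 and y for a reflection, and take A = {1, y},
   B = {1, xy}, C = {1, x^2 y, x^3 y} in D_4. The triple product property almost
   holds: a relation q1 q2 = (s t^-1)^-1 with q1 in Q(A), q2 in Q(B) and s, t in C
   is trivial unless s = x^3 y and t = x^2 y. In D_4^k a relation among words over
   A, B and C can thus only increase the number of letters x^2 y, so words of C^k
   having a fixed number of them satisfy the property together with A^k and B^k.
   The largest such class has at least 3^k / (k + 1) elements, whence
   nmp >= 12^k / (k + 1), while the order of the group is 8^k. *)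
Require Import Defs.
From mathcomp Require Import all_boot all_order all_algebra.
From mathcomp Require Import all_fingroup all_solvable.
From mathcomp Require Import all_classical all_reals all_analysis.
From mathcomp Require Import ring lra.

Set Implicit Arguments.
Unset Strict Implicit.
Unset Printing Implicit Defensive.

Import Order.TTheory GRing.Theory Num.Theory.
Import numFieldNormedType.Exports.

Local Open Scope classical_set_scope.
Local Open Scope ring_scope.

(** At most [k + 1] weights occur, so the largest weight class has at least average size. *)
Lemma pigeonhole_weight (T : finType) (S : {set T}) (W : T -> nat) (k : nat) :
  {in S, forall f, (W f <= k)%N} ->
  exists j, (#|S| <= k.+1 * #|[set f in S | W f == j]%SET|)%N.
Proof.
move=> Wk; pose F (j : 'I_k.+1) := #|[set f in S | W f == j]%SET|.
have [|j Fj] := @bigop.eq_bigmax _ F; first by rewrite card_ord.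
exists (nat_of_ord j); rewrite -/(F j) -Fj -sum1_card.
rewrite (partition_big (fun f => inord (W f) : 'I_k.+1) xpredT)//=.
apply: (@leq_trans (\sum_(i < k.+1) \max_i F i)%N); last first.
  by rewrite sum_nat_const card_ord.
apply: leq_sum => i _.
apply: leq_trans (leq_bigmax i); rewrite sum1_card subset_leq_card//.
apply/fintype.subsetP => f; rewrite !inE => /andP[fS /eqP <-].
by rewrite fS inordK ?eqxx// ltnS Wk.
Qed.

Definition words (gT : finGroupType) (A : {set gT}) (k : nat) :
  {set group_pow gT k} := [set f : group_pow gT k | [forall i, f i \in A]]%SET.

Lemma wordsP (gT : finGroupType) (A : {set gT}) (k : nat) (f : group_pow gT k) :
  reflect (forall i, f i \in A) (f \in words A k).
Proof. by rewrite inE; exact: forallP. Qed.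

Lemma card_words (gT : finGroupType) (A : {set gT}) (k : nat) :
  #|words A k| = (#|A| ^ k)%N.
Proof.
rewrite -[k in RHS]card_ord -card_ffun_on cardsE.
by apply: eq_card => f; apply/forallP/ffun_onP => + i => /(_ i).
Qed.

Lemma card_group_pow (gT : finGroupType) (k : nat) :
  #|group_pow gT k| = (#|gT| ^ k)%N.
Proof.
rewrite -!cardsT -card_words; apply: eq_card => f.
by rewrite inE; apply/esym/wordsP => i; rewrite inE.
Qed.

Lemma quot_words (gT : finGroupType) (A : {set gT}) (k : nat)
    (q : group_pow gT k) (i : 'I_k) :
  q \in quot_set (words A k) -> q i \in quot_set A.
Proof.
move=> /imset2P[f g /wordsP fA /wordsP gA ->].
by rewrite mulg_ffun invg_ffun; exact: imset2_f.
Qed.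

(* [A], [B], [C] may violate the triple product property in one direction only,
   that in which [w] increases. This is harmless among words in [C] of equal
   total weight, and some weight class contains 1/(k+1) of all the words. *)
Lemma power_realizes (gT : finGroupType) (A B C : {set gT}) (w : pred gT)
    (k : nat) :
  (forall q1 q2 s t : gT, q1 \in quot_set A -> q2 \in quot_set B ->
     s \in C -> t \in C -> (q1 * q2 * (s * t^-1) = 1)%g ->
     (w s < w t)%N \/ [/\ q1 = 1, q2 = 1 & s = t]%g) ->
  exists2 p : nat, (#|C| ^ k <= k.+1 * p)%N &
    realizes (group_pow gT k) (#|A| ^ k) (#|B| ^ k) p.
Proof.
move=> ABC; pose W (f : group_pow gT k) := (\sum_i w (f i))%N.
have [|j Cj] := @pigeonhole_weight _ (words C k) W k.
  move=> f _; rewrite -[k in leqRHS]card_ord -sum1_card.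
  by apply: leq_sum => i _; case: (w _).
rewrite -card_words; exists #|[set f in words C k | W f == j]%SET| => //.
exists (words A k), (words B k), [set f in words C k | W f == j]%SET.
split; rewrite ?card_words// => q1 q2 q3 q1A q2B /imset2P[f g].
move=> /setIdP[/wordsP fC /eqP Wf] /setIdP[/wordsP gC /eqP Wg] q3E qE.
have loc i : (w (f i) < w (g i))%N \/
             [/\ q1 i = 1, q2 i = 1 & f i = g i]%g.
  apply: ABC; rewrite ?quot_words//.
  by rewrite -invg_ffun -!mulg_ffun -q3E qE ffunE.
have wle i : (w (f i) <= w (g i))%N by case: (loc i) => [/ltnW|[_ _ ->]].
(* Both words have total weight [j], so the coordinatewise inequalities of weights are equalities;
   this excludes the strict alternative in every coordinate. *)
have := leqif_sum (fun i (_ : xpredT i) => leqif_eq (wle i)).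
rewrite -/(W f) -/(W g) Wf Wg => -[_]; rewrite eqxx => /esym/forallP weq.
have {}loc i : [/\ q1 i = 1, q2 i = 1 & f i = g i]%g.
  by case: (loc i) => //; rewrite (eqP (weq i)) ltnn.
have fg : f = g by apply/ffunP => i; case: (loc i).
split; rewrite ?q3E ?fg ?mulgV//;
  by apply/ffunP => i; rewrite ffunE; case: (loc i).
Qed.

(** Here [h i b] is [x^i y^b]. Exponents are naturals modulo 4, with [3 * j] in place of [-j], so
    that equations in the group are decided by computation. *)
Lemma dihedral4_normal_form :
  exists2 h : nat -> bool -> dihedral 4, (h 0 false = 1)%g &
  [/\ forall i j b c, (h i b == h j c) = (i == j %[mod 4])%N && (b == c),
      forall i j b c,
        (h i b * h j c)%g = h (i + (if b then 3 * j else j))%N (b (+) c) &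
      forall i b, (h i b)^-1%g = h (if b then i else 3 * i)%N b].
Proof.
have [//|[x y]] := @generators_2dihedral _ [set: dihedral 4]%G 3 _ (isog_refl _).
move=> [_ _ ox]; rewrite inE => /andP[ynx _] [oy xy].
have {}ox : #[x]%g = 4%N by [].
have x4 : (x ^+ 4 = 1)%g by have := expg_order x; rewrite ox.
have y2 : (y * y = 1)%g by have := expg_order y; rewrite oy expg2.
pose h i (b : bool) := (x ^+ i * y ^+ b)%g.
have heq i j b c : (h i b == h j c) = (i == j %[mod 4])%N && (b == c).
  have yn (d e : nat) : (x ^+ d == x ^+ e * y)%g = false.
    apply: contraNF ynx => /eqP/esym/(canRL (mulKg _)) ->.
    by rewrite groupM ?groupV ?mem_cycle.
  rewrite /h; case: b c => -[]; rewrite ?andbF ?andbT /= ?mulg1.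
  - by rewrite (can_eq (mulgK y)) eq_expg_mod_order ox.
  - by rewrite eq_sym yn.
  - by rewrite yn.
  - by rewrite eq_expg_mod_order ox.
have hM i j b c :
    (h i b * h j c)%g = h (i + (if b then 3 * j else j))%N (b (+) c).
  have yx : (y * x ^+ j = x ^+ (3 * j) * y)%g.
    have x3 : (x ^+ 3 = x^-1)%g.
      by apply/eqP; rewrite eq_sym eq_invg_mul -expgS x4.
    have yV : (y^-1 = y)%g.
      by apply/eqP; rewrite eq_invg_mul y2.
    rewrite expgM x3 -xy -conjXg conjgE yV -!mulgA.
    by rewrite y2 mulg1.
  rewrite /h; case: b => /=; last by rewrite mulg1 expgD mulgA.
  rewrite expg1 expgD -!mulgA; congr (_ * _)%g.
  rewrite mulgA yx -mulgA; congr (_ * _)%g; case: c => /=.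
  by rewrite expg1 y2.
  by rewrite mulg1 expg1.
have h1 : h 0 false = 1%g by rewrite /h mulg1.
exists h => //; split => // i b.
apply/eqP; rewrite eq_invg_mul hM -h1 heq addbb eqxx andbT.
by case: b => //=; rewrite -mulSn ?modnMr// -mulnDl.
Qed.

Lemma cvg_sqrt_harmonic (R : realType) (c : R) :
  (fun k : nat => c * Num.sqrt (k.+1%:R^-1)) @ \oo --> (0 : R).
Proof.
rewrite -(mulr0 c) -[X in c * X]sqrtr0; apply: cvgMr.
by apply: cvg_comp; [exact: cvg_harmonic | exact: sqrt_continuous].
Qed.

Lemma ln_ge_1BV (R : realType) (x : R) : 0 < x -> 1 - x^-1 <= ln x.
Proof.
move=> x0; have xV : 0 < x^-1 by rewrite invr_gt0.
have := @le_ln1Dx R (x^-1 - 1) ltac:(lra).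
by rewrite addrC subrK lnV ?posrE//; lra.
Qed.

Lemma ln12E (R : realType) : ln 12 = 2 * ln 2 + ln 3 :> R.
Proof.
rewrite (_ : 12 = 2 ^+ 2 * 3); last by ring.
by rewrite lnM ?posrE// lnXn// mulr_natl.
Qed.

Lemma ln12_ge (R : realType) : 5 / 3 <= ln 12 :> R.
Proof.
(* The bounds [ln 2 >= 1/2] and [ln 3 >= 2/3] add up to [2 * 1/2 + 2/3 = 5/3]. *)
rewrite ln12E; have := @ln_ge_1BV R 2 ltac:(lra).
by have := @ln_ge_1BV R 3 ltac:(lra); lra.
Qed.

Lemma logb_12_8_bounds (R : realType) :
  251 / 100 <= (3 * logb 12 8 : R) < 252 / 100.
Proof.
have l12 := ln12_ge R; have e12 := ln12E R.
have e8 : ln 8 = 3 * ln 2 :> R.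
  by rewrite (_ : 8 = 2 ^+ 3); [rewrite lnXn// mulr_natl | ring].
(* The fractions 65/41 and 11/7 enclose [log_2 3], as [3^41 <= 2^65] and [2^11 < 3^7]. The bound
   2.52 amounts exactly to [11/7 < log_2 3]. *)
have up : 41 * ln 3 <= 65 * ln 2 :> R.
  rewrite !mulr_natl -!lnXn// ler_ln ?posrE ?exprn_gt0//.
  lra.
have lo : 11 * ln 2 < 7 * ln 3 :> R.
  rewrite !mulr_natl -!lnXn// ltr_ln ?posrE ?exprn_gt0//.
  lra.
have p : 0 < ln 12 :> R by lra.
by rewrite /logb mulrA ler_pdivlMr// ltr_pdivrMr//; lra.
Qed.

(** With [s = (k + 1)^(-1/2)] the left-hand side is [2 s ln (1/s)], and [ln t < t]. *)
Lemma ln_succ_le (R : realType) (k : nat) :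
  ln k.+1%:R * Num.sqrt (k.+1%:R^-1) <= 2 :> R.
Proof.
set s := Num.sqrt _; have s0 : 0 < s by rewrite sqrtr_gt0 invr_gt0.
have s2 : k.+1%:R = s^-1 ^+ 2 :> R.
  by rewrite exprVn sqr_sqrtr ?invrK// invr_ge0.
rewrite s2 lnXn ?invr_gt0// -ler_pdivlMr// -mulr_natl.
have : ln s^-1 < s^-1 by rewrite ln_sublinear// invr_gt0.
by lra.
Qed.

(** Here [p] stands for the whole product of the three sizes. With [s = (k + 1)^(-1/2)], the loss
    [ln (k + 1)] is at most [6 s ln p], so [k ln 12 <= (1 + 6 s) ln p]; tripling gives
    [3 + 18 s]. *)
Lemma exponent_bound (R : realType) (k p : nat) : (0 < k)%N ->
  (12 ^ k <= k.+1 * p)%N ->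
  [/\ (1 < p)%N & 3 * ln (8 ^ k)%:R / ln p%:R
    <= (3 + 18 * Num.sqrt (k.+1%:R^-1)) * logb 12 8 :> R].
Proof.
move=> k0 kp; have l12 := ln12_ge R.
have p0 : (0 < p)%N.
  by case: p kp => //; rewrite muln0 leqn0 expn_eq0.
have k1 : 1 <= k%:R :> R by rewrite ler1n.
have lnk : ln k.+1%:R <= k%:R :> R.
  by rewrite -add1n natrD le_ln1Dx// (lt_le_trans _ (ler0n _ _))//; lra.
have : k%:R * ln 12 <= ln k.+1%:R + ln p%:R :> R.
  rewrite mulr_natl -lnXn// -lnM ?posrE ?ltr0n// ler_ln ?posrE ?exprn_gt0//.
    by rewrite -natrX -natrM ler_nat.
  by rewrite mulr_gt0 ?ltr0n.
set s := Num.sqrt _.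
have s0 : 0 < s by rewrite sqrtr_gt0 invr_gt0.
have lns : ln k.+1%:R * s <= 2 by exact: ln_succ_le.
have s2k : 1 <= 2 * s ^+ 2 * k%:R.
  rewrite sqr_sqrtr ?invr_ge0// mulrAC ler_pdivlMr// -natr1; lra.
move: lnk lns; set a := ln k.+1%:R; set b := ln p%:R => lnk lns kab.
(* Since [ln 12 >= 5/3] and [a <= k], one has [5/3 k <= k + b]. *)
have kb : 2 / 3 * k%:R <= b by nra.
have b0 : 0 < b by lra.
split.
  rewrite ltn_neqAle p0 andbT eq_sym; apply: contraTneq b0 => p1.
  by rewrite /b p1 ln1 ltxx.
(* The chain [s a <= 2 <= 4 s^2 k <= 6 s^2 b] holds, and one factor [s] cancels. *)
have as2 : a <= 6 * s * b.
  have : s * a <= s * (6 * s * b).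
    have : s ^+ 2 * (2 / 3 * k%:R) <= s ^+ 2 * b by rewrite ler_wpM2l// sqr_ge0.
    lra.
  by rewrite ler_pM2l.
have l8 : 0 <= ln 8 :> R by rewrite ln_ge0//; lra.
rewrite /logb natrX lnXn// -mulr_natl ler_pdivrMr//.
rewrite [leRHS](_ : _ = (3 + 18 * s) * ln 8 * b / ln 12); last by ring.
rewrite ler_pdivlMr; last by lra.
suff : ln 8 * (k%:R * ln 12) <= ln 8 * ((1 + 6 * s) * b) by lra.
by rewrite ler_wpM2l//; lra.
Qed.

(* With [h i b] standing for [x^i y^b], the sets are [{1, y}], [{1, xy}] and
   [{1, x^2 y, x^3 y}]. *)
Lemma dihedral4_pow_realizes (k : nat) :
  exists2 p : nat, (3 ^ k <= k.+1 * p)%N &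
    realizes (group_pow (dihedral 4) k) (2 ^ k) (2 ^ k) p.
Proof.
have [h h1 [hE hM hV]] := dihedral4_normal_form.
pose A := [set h 0 false; h 0 true]%SET.
pose B := [set h 0 false; h 1 true]%SET.
pose C := [set h 0 false; h 2 true; h 3 true]%SET.
have cA : #|A| = 2%N by rewrite cards2 hE.
have cB : #|B| = 2%N by rewrite cards2 hE.
have cC : #|C| = 3%N by rewrite /C finset.setUC cardsU1 !inE cards2 !hE.
(* As [h i true] is an involution, [{1, h i true}] is its own quotient set. *)
have quotE i q : q \in quot_set [set h 0 false; h i true]%SET ->
    q = h 0 false \/ q = h i true.
  by move=> /imset2P[s t /set2P[]-> /set2P[]-> ->];
    rewrite hV hM /=; [left|right|right|left]; apply/eqP;
    rewrite hE ?eqxx ?andbT ?muln0 ?addn0 // -mulSn modnMr.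
have := @power_realizes _ A B C (pred1 (h 2 true)) k.
rewrite cA cB cC => pow; apply: pow => q1 q2 s t /quotE q1E /quotE q2E.
rewrite !inE -!orbA.
(* Of the 36 cases one is neither contradictory nor trivial: [y * xy * (x^3 y) (x^2 y)^-1 = 1],
   where the weight rises from 0 to 1. *)
case: q1E => ->; case: q2E => -> /or3P[] /eqP-> /or3P[] /eqP->;
  rewrite hV !hM -!h1 => /eqP; rewrite !hE //=; try by right.
by left.
Qed.

Theorem corollary7p8 (R : realType) :
  exists eps : nat -> R,
    [/\ eps @ \oo --> (0 : R),
        forall k : nat,
          pseudo_exponent R (group_pow (dihedral 4) k)
            <= (3 + eps k) * logb 12 8,
        (fun k : nat => (3 + eps k) * logb 12 8) @ \oo --> (3 * logb 12 8 : R) &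
        251 / 100 <= (3 * logb 12 8 : R) < 252 / 100].
Proof.
have cvg0 := @cvg_sqrt_harmonic R 18; have bnd := logb_12_8_bounds R.
exists (fun k => 18 * Num.sqrt k.+1%:R^-1); split=> //; last first.
  by apply: cvgMl; rewrite -[X in _ --> X]addr0; apply: cvgD => //; exact: cvg_cst.
case=> [|k]; set G := group_pow _ _.
  (* For [k = 0] the group is trivial, with exponent 3 by convention, and the bound is
     [21 log_12 8]. *)
  rewrite pseudo_exponent_triv; last by rewrite card_group_pow.
  by rewrite invr1 sqrtr1; lra.
have card_G : #|G| = (8 ^ k.+1)%N by rewrite card_group_pow card_dihedralT.
have [p kp Gp] := dihedral4_pow_realizes k.+1.
have [|N1 bound] := @exponent_bound R k.+1 (2 ^ k.+1 * 2 ^ k.+1 * p)%N isT.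
  rewrite mulnCA -!expnMn (_ : 12 = 2 * 2 * 3)%N// expnMn leq_mul2l.
  by rewrite kp orbT.
apply: le_trans bound; rewrite -card_G.
apply: (pseudo_exponent_min R _).2.
  by rewrite card_G -(expn0 8) eqn_exp2l.
exists (2 ^ k.+1)%N, (2 ^ k.+1)%N, p; split => //.
  by split; rewrite ?expn_gt0//; case: p N1 {kp Gp}; rewrite ?muln0.
by move=> [/eqP]; rewrite -(expn0 2) eqn_exp2l.
Qed.
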